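(* Consider SEGA with arbitrary sampling (defined in the context) with stepsize $\alpha=\min_i\frac{p_i}{4m_i+\sigma}$. Then its iteration complexity is $\max_i\left(\frac{4m_i+\sigma}{p_i\sigma}\right)\log\frac1\epsilon$; that is, there exists $b\in\mathbb R^d$ with positive entries such that, with $$\Psi^k=\|x^k-x^*\|^2+\alpha\sum_{i=1}^d\frac{b_i^2}{m_i}\left(h_i^k-\nabla_if(x^* )\right)^2,$$ for every $\epsilon\in(0,1)$ and every integer $k\ge\max_i\left(\frac{4m_i+\sigma}{p_i\sigma}\right)\log\frac1\epsilon$ we have $\mathbb E[\Psi^k]\le\epsilon\,\Psi^0$.
   Context: Problem. $f:\mathbb R^d\to\mathbb R$ is differentiable and convex, $\psi:\mathbb R^d\to\mathbb R\cup\{+\infty\}$ is proper, closed and convex. $\min_x f(x)+\psi(x)$ has a unique minimizer $x^*$, and $f$ is $\sigma$-quasi strongly convex with $\sigma>0$: $f(x^* )\ge f(y)+\langle\nabla f(y),x^*-y\rangle+\frac\sigma2\|y-x^*\|^2$ for all $y$. $f$ is $\mathbf M$-smooth with $\mathbf M=\mathrm{diag}(m_1,\dots,m_d)$, $m_1,\dots,m_d>0$: $f(x)\le f(y)+\langle\nabla f(y),x-y\rangle+\frac12\sum_i m_i(x_i-y_i)^2$ for all $x,y$. $\mathrm{prox}_{\alpha\psi}(x)=\arg\min_u\{\alpha\psi(u)+\frac12\|u-x\|^2\}$; $e_i$ is the $i$-th standard basis vector of $\mathbb R^d$; $\nabla_i f$ is the $i$-th partial derivative. Sampling. $L$ is a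 random subset of $[d]=\{1,\dots,d\}$ with arbitrary distribution such that $p_i=\mathbb P(i\in L)>0$ for all $i$. Algorithm (SEGA with arbitrary sampling). Given $x^0\in\mathbb R^d$, set $h^0=0\in\mathbb R^d$. For $k=0,1,2,\dots$: draw $L^k$, a copy of $L$ independent of the past; $h^{k+1}=h^k+\sum_{i\in L^k}(\nabla_if(x^k)-h_i^k)e_i$; $g^k=h^k+\sum_{i\in L^k}\frac1{p_i}(\nabla_if(x^k)-h_i^k)e_i$; $x^{k+1}=\mathrm{prox}_{\alpha\psi}(x^k-\alpha g^k)$. *)

(* Defs.v *)
From HB Require Import structures.
From mathcomp Require Export all_boot all_order all_algebra.
From mathcomp Require Export all_classical all_reals all_analysis.
Export Order.TTheory GRing.Theory Num.Theory.
Export numFieldNormedType.Exports.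

Set Implicit Arguments.
Unset Strict Implicit.
Unset Printing Implicit Defensive.

Local Open Scope classical_set_scope.
Local Open Scope ring_scope.

(* R^d is 'rV[R]_n.+1 with d = n.+1, so that the minima and maxima over the
   coordinates range over a nonempty index set. The library norm `|x| on row
   vectors is the sup norm; [sqnorm] below is the square of the Euclidean one. *)

Definition min_ord (R : realType) (n : nat) (F : 'I_n.+1 -> R) : R :=
  \big[Num.min/F ord0]_(i < n.+1) F i.

Definition max_ord (R : realType) (n : nat) (F : 'I_n.+1 -> R) : R :=
  \big[Num.max/F ord0]_(i < n.+1) F i.

Definition dotp (R : realType) (n : nat) (u v : 'rV[R]_n) : R :=
  \sum_(i < n) u ord0 i * v ord0 i.

Definition sqnorm (R : realType) (n : nat) (u : 'rV[R]_n) : R := dotp u u.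

Definition basis_vec (R : realType) (n : nat) (i : 'I_n) : 'rV[R]_n :=
  delta_mx ord0 i.

Definition grad (R : realType) (n : nat) (f : 'rV[R]_n.+1 -> R)
    (x : 'rV[R]_n.+1) : 'rV[R]_n.+1 :=
  \row_(i < n.+1) 'D_(basis_vec R i) f x.

(* Extended-real-valued functions. A function to R \cup {+oo} is a function to
   \bar R that avoids -oo, which is part of properness. *)

Definition proper_fun (R : realType) (T : Type) (psi : T -> \bar R) : Prop :=
  (forall x, psi x != -oo%E) /\ (exists x, (psi x < +oo)%E).

Definition epigraph (R : realType) (T : Type) (psi : T -> \bar R) :
    set (T * R) :=
  [set z | (psi z.1 <= z.2%:E)%E].

Definition closed_fun (R : realType) (n : nat) (psi : 'rV[R]_n.+1 -> \bar R) :
    Prop :=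
  closed (epigraph psi).

(* Meaningful together with [proper_fun]: the right-hand side is then never
   of the form +oo - oo; at the endpoints of [0, 1], 0 * +oo = 0. *)
Definition econvex_fun (R : realType) (n : nat) (psi : 'rV[R]_n.+1 -> \bar R) :
    Prop :=
  forall (x y : 'rV[R]_n.+1) (t : R), 0 <= t -> t <= 1 ->
    (psi (t *: x + (1 - t) *: y)%R <= t%:E * psi x + (1 - t)%R%:E * psi y)%E.

Definition argmin (R : realType) (T : Type) (F : T -> \bar R) : set T :=
  [set u | forall v, (F u <= F v)%E].

(* The element of the argmin. When psi is proper, closed and convex and
   0 < alpha the argmin is a singleton, and the default value is not used. *)
Definition prox (R : realType) (n : nat) (alpha : R)
    (psi : 'rV[R]_n.+1 -> \bar R) (x : 'rV[R]_n.+1) : 'rV[R]_n.+1 :=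
  xget 0 (argmin (fun u : 'rV[R]_n.+1 =>
    (alpha%:E * psi u + (2^-1 * sqnorm (u - x))%R%:E)%E)).

Definition quasi_strongly_convex (R : realType) (n : nat) (sigma : R)
    (f : 'rV[R]_n.+1 -> R) (xs : 'rV[R]_n.+1) : Prop :=
  forall y, f xs >= f y + dotp (grad f y) (xs - y)
                    + sigma / 2 * sqnorm (y - xs).

Definition diag_smooth (R : realType) (n : nat) (m : 'I_n.+1 -> R)
    (f : 'rV[R]_n.+1 -> R) : Prop :=
  forall x y, f x <= f y + dotp (grad f y) (x - y)
    + 2^-1 * \sum_(i < n.+1) m i * (x ord0 i - y ord0 i) ^+ 2.

Definition random_set (d : measure_display) (T : measurableType d) (n : nat)
    (L : T -> {set 'I_n}) : Prop :=
  forall S : {set 'I_n}, measurable (L @^-1` [set S]).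

Definition inclusion_prob (R : realType) (d : measure_display)
    (T : measurableType d) (P : probability T R) (n : nat)
    (L : T -> {set 'I_n}) (i : 'I_n) : R :=
  fine (P [set w | i \in L w]).

(* Each Ls k is distributed as L and is independent of the tuple
   (Ls 0, .., Ls (k - 1)). *)
Definition independent_copies (R : realType) (d : measure_display)
    (T : measurableType d) (P : probability T R) (n : nat)
    (L : T -> {set 'I_n}) (Ls : nat -> T -> {set 'I_n}) : Prop :=
  let past k w := mkseq (fun j => Ls j w) k in
  [/\ forall k, random_set (Ls k),
      forall k (A : set {set 'I_n}), P (Ls k @^-1` A) = P (L @^-1` A) &
      forall k (A : set {set 'I_n}) (B : set (seq {set 'I_n})),
        P (Ls k @^-1` A `&` past k @^-1` B)
        = (P (Ls k @^-1` A) * P (past k @^-1` B))%E].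

(* One iteration (x^k, h^k) |-> (x^(k+1), h^(k+1)) when the drawn set is S;
   gf stands for the gradient of f. *)
Definition sega_step (R : realType) (n : nat) (alpha : R)
    (psi : 'rV[R]_n.+1 -> \bar R) (gf : 'rV[R]_n.+1 -> 'rV[R]_n.+1)
    (p : 'I_n.+1 -> R) (S : {set 'I_n.+1})
    (xh : 'rV[R]_n.+1 * 'rV[R]_n.+1) : 'rV[R]_n.+1 * 'rV[R]_n.+1 :=
  let x := xh.1 in
  let h := xh.2 in
  let h' := h + \sum_(i in S) (gf x ord0 i - h ord0 i) *: basis_vec R i in
  let g := h + \sum_(i in S)
    ((p i)^-1 * (gf x ord0 i - h ord0 i)) *: basis_vec R i in
  (prox alpha psi (x - alpha *: g), h').

Fixpoint sega (R : realType) (n : nat) (alpha : R)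
    (psi : 'rV[R]_n.+1 -> \bar R) (gf : 'rV[R]_n.+1 -> 'rV[R]_n.+1)
    (p : 'I_n.+1 -> R) (x0 : 'rV[R]_n.+1) (Ss : nat -> {set 'I_n.+1})
    (k : nat) : 'rV[R]_n.+1 * 'rV[R]_n.+1 :=
  if k is k'.+1 then
    sega_step alpha psi gf p (Ss k') (sega alpha psi gf p x0 Ss k')
  else (x0, 0).

Definition lyapunov (R : realType) (n : nat) (alpha : R) (m b : 'I_n.+1 -> R)
    (gf : 'rV[R]_n.+1 -> 'rV[R]_n.+1) (xs : 'rV[R]_n.+1)
    (xh : 'rV[R]_n.+1 * 'rV[R]_n.+1) : R :=
  sqnorm (xh.1 - xs)
  + alpha * \sum_(i < n.+1)
      b i ^+ 2 / m i * (xh.2 ord0 i - gf xs ord0 i) ^+ 2.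

(* Main.v *)
Require Import Defs.
From mathcomp Require Import all_boot all_order all_algebra.
From mathcomp Require Import all_classical all_reals all_analysis.
From mathcomp Require Import measurable_realfun.
From mathcomp Require Import ring lra.

(* Quasi-strong convexity together with the Bregman bound
   f(x) - f(xs) - <grad f(xs), x - xs> >= sum_i (grad_i f(x) - grad_i f(xs))^2 / (2 m_i)
   absorbs the variance of the estimator g^k, coordinate by coordinate, once the
   Lyapunov weights are b_i^2 = 1 / (2 p_i): conditionally on the past, one
   iteration contracts the Lyapunov function by the factor 1 - alpha sigma.
   The prox step is harmless because xs satisfies
   psi(u) >= psi(xs) - <grad f(xs), u - xs>, which makes it nonexpansive
   towards xs; the same affine minorant of psi gives the existence of the prox. *)

Import Order.TTheory GRing.Theory Num.Theory.

Set Implicit Arguments.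
Unset Strict Implicit.
Unset Printing Implicit Defensive.

Local Open Scope classical_set_scope.
Local Open Scope ring_scope.

(** * Euclidean inner product and Young's inequality *)

Section InnerProduct.
Context {R : realType} {n : nat}.
Implicit Types (u v w : 'rV[R]_n) (a : R).

Lemma dotpC u v : dotp u v = dotp v u.
Proof. by apply: eq_bigr => i _; rewrite mulrC. Qed.

Lemma dotpDl u v w : dotp (u + v) w = dotp u w + dotp v w.
Proof. by rewrite -big_split; apply: eq_bigr => i _; rewrite mxE mulrDl. Qed.

Lemma dotpZl a u v : dotp (a *: u) v = a * dotp u v.
Proof. by rewrite mulr_sumr; apply: eq_bigr => i _; rewrite mxE mulrA. Qed.

Lemma dotpNl u v : dotp (- u) v = - dotp u v.
Proof. by rewrite -scaleN1r dotpZl mulN1r. Qed.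

Lemma dotpDr u v w : dotp w (u + v) = dotp w u + dotp w v.
Proof. by rewrite dotpC dotpDl !(dotpC w). Qed.

Lemma dotpZr a u v : dotp v (a *: u) = a * dotp v u.
Proof. by rewrite dotpC dotpZl (dotpC v). Qed.

Lemma dotpNr u v : dotp v (- u) = - dotp v u.
Proof. by rewrite dotpC dotpNl (dotpC v). Qed.

Definition dotpE := (dotpDl, dotpDr, dotpNl, dotpNr, dotpZl, dotpZr).

Lemma sqnormE u : sqnorm u = \sum_(i < n) u ord0 i ^+ 2.
Proof. by apply: eq_bigr => i _; rewrite expr2. Qed.

Lemma sqnorm_ge0 u : 0 <= sqnorm u.
Proof. by rewrite sqnormE sumr_ge0// => i _; rewrite sqr_ge0. Qed.

Lemma sqr_coord_le_sqnorm u i : u ord0 i ^+ 2 <= sqnorm u.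
Proof.
rewrite sqnormE (bigD1 i)//= lerDl sumr_ge0// => j _.
by rewrite sqr_ge0.
Qed.

Lemma young_dotp a u v : 0 < a -> 2 * dotp u v <= a * sqnorm u + a^-1 * sqnorm v.
Proof.
move=> a0; have := sqnorm_ge0 (a *: u - v).
rewrite /sqnorm !dotpE (dotpC v u) => h.
rewrite -(ler_pM2l a0).
have -> : a * (a * dotp u u + a^-1 * dotp v v) = a ^+ 2 * dotp u u + dotp v v.
  by field; rewrite gt_eqF.
lra.
Qed.

End InnerProduct.

(* Letting t tend to 0 without limits. *)
Lemma le_of_le_addM (R : realType) (a b c : R) :
  (forall t, 0 < t -> t <= 1 -> a <= b + t * c) -> a <= b.
Proof.
move=> h; rewrite leNgt; apply/negP => ba.
have D : 0 < 1 + `|c| + (a - b) by have := normr_ge0 c; lra.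
(* With this [t] one has t * |c| < a - b, which contradicts the hypothesis at [t]. *)
pose t := (a - b) / (1 + `|c| + (a - b)).
have t0 : 0 < t by rewrite divr_gt0// subr_gt0.
have t1 : t <= 1 by rewrite ler_pdivrMr// mul1r; have := normr_ge0 c; lra.
have ct : t * c <= t * `|c| by rewrite ler_pM2l// ler_norm.
have tE : t * (1 + `|c| + (a - b)) = a - b by rewrite divfK// gt_eqF.
have := h t t0 t1.
have : 0 < t * (a - b) by rewrite mulr_gt0// subr_gt0.
lra.
Qed.

(** Passes from a weight bundled with its membership in [0, 1] to a plain real weight. *)
Lemma convex_functionE (R : realType) (V : lmodType R) (f : V -> R) :
  @convex_function R V setT f -> forall (x y : V) (t : R), 0 <= t -> t <= 1 ->
  f (t *: x + (1 - t) *: y) <= t * f x + (1 - t) * f y.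
Proof.
move=> hf x y t t0 t1.
have ht : Itv.spec (@Itv.num_sem R) (Itv.Real `[0%Z, 1%Z]) t.
  by rewrite /Itv.spec /= /Itv.num_sem /= in_itv /= ger0_real //= t0 t1.
exact: (hf (Itv.mk ht) x y (in_setT _) (in_setT _)).
Qed.

(** * First-order inequalities for convex smooth functions *)

Section FirstOrder.
Context {R : realType} {n : nat}.
Variables (f : 'rV[R]_n.+1 -> R) (m : 'I_n.+1 -> R).
Hypotheses (hf_convex : convex_function setT f) (hsmooth : diag_smooth m f).

(* Smoothness bounds f on the opposite side of x, and x lies between that point
   and y; no differentiability is needed. *)
Lemma convex_smooth_grad_le x y : f x + dotp (grad f x) (y - x) <= f y.
Proof.
pose C := 2^-1 * \sum_(i < n.+1) m i * (y ord0 i - x ord0 i) ^+ 2.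
apply: (@le_of_le_addM _ _ _ C) => t t0 t1.
have t1p : 0 < 1 + t by lra.
have := convex_functionE hf_convex (x - t *: (y - x)) y (t := (1 + t)^-1).
have -> : (1 + t)^-1 *: (x - t *: (y - x)) + (1 - (1 + t)^-1) *: y = x.
  by apply/rowP => i; rewrite !mxE; field; rewrite gt_eqF.
have i0 : 0 <= (1 + t)^-1 by rewrite invr_ge0 ltW.
have i1 : (1 + t)^-1 <= 1 by rewrite invf_le1//; lra.
move=> /(_ i0 i1); rewrite -(ler_pM2l t1p).
have -> : forall A B, (1 + t) * ((1 + t)^-1 * A + (1 - (1 + t)^-1) * B)
    = A + t * B by move=> A B; field; rewrite gt_eqF.
have := hsmooth (x - t *: (y - x)) x.
have -> : x - t *: (y - x) - x = - t *: (y - x).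
  by apply/rowP => i; rewrite !mxE; ring.
have -> : 2^-1 * (\sum_(i < n.+1) m i * ((x - t *: (y - x)) ord0 i - x ord0 i) ^+ 2)
    = t ^+ 2 * C.
  rewrite /C [RHS]mulrCA; congr (_ * _); rewrite mulr_sumr; apply: eq_bigr => i _.
  by rewrite !mxE; ring.
rewrite dotpZr => h1 h2; rewrite -(ler_pM2l t0); lra.
Qed.

(** Evaluate [f] at [x - a], with [a] the gradient difference scaled by the inverse of diag(m):
    convexity at [y] bounds the value from below, smoothness at [x] from above. This [a] is the
    displacement that makes the resulting bound strongest. *)
Lemma bregman_ge (hm : forall i, 0 < m i) x y :
  f y + dotp (grad f y) (x - y) + 2^-1 * \sum_(i < n.+1)
     (grad f x ord0 i - grad f y ord0 i) ^+ 2 / m i <= f x.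
Proof.
pose a := \row_(i < n.+1) ((grad f x ord0 i - grad f y ord0 i) / m i).
have := hsmooth (x - a) x; have := convex_smooth_grad_le y (x - a).
have -> : x - a - x = - a by rewrite addrAC subrr add0r.
have -> : x - a - y = (x - y) - a by rewrite addrAC.
rewrite !dotpE.
have -> : \sum_(i < n.+1) m i * ((x - a) ord0 i - x ord0 i) ^+ 2
  = \sum_(i < n.+1) (grad f x ord0 i - grad f y ord0 i) ^+ 2 / m i.
  by apply: eq_bigr => i _; rewrite !mxE; field; rewrite gt_eqF.
have : dotp (grad f x) a - dotp (grad f y) a =
  \sum_(i < n.+1) (grad f x ord0 i - grad f y ord0 i) ^+ 2 / m i.
  rewrite -sumrB; apply: eq_bigr => i _.
  by rewrite -mulrBl [a _ _]mxE expr2 mulrA.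
lra.
Qed.

End FirstOrder.

(** * Optimality condition for composite minimization *)

Section Prox.
Context {R : realType} {n : nat}.
Variables (psi : 'rV[R]_n.+1 -> \bar R).
Hypotheses (hproper : proper_fun psi) (hconvex : econvex_fun psi).

Lemma econvex_fin x y (r s t : R) : psi x = r%:E -> psi y = s%:E ->
  0 <= t -> t <= 1 -> exists2 q, psi (t *: x + (1 - t) *: y) = q%:E &
    q <= t * r + (1 - t) * s.
Proof.
move=> hx hy t0 t1; have := hconvex x y t0 t1; rewrite hx hy.
have := hproper.1 (t *: x + (1 - t) *: y).
case: psi => [q| |]//= _ ; rewrite -?EFinM -?EFinD ?lee_fin ?leye_eq//.
by exists q.
Qed.

(* For the smooth part f this is the first-order optimality condition; for a
   quadratic f it is the variational inequality of the prox. *)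
Lemma argmin_subgradient (f : 'rV[R]_n.+1 -> R) (a : R) xs g (C : 'rV[R]_n.+1 -> R) :
  0 < a ->
  (forall v t, 0 < t -> t <= 1 -> f (xs + t *: v) <= f xs + t * dotp g v + t ^+ 2 * C v) ->
  argmin (fun x => a%:E * psi x + (f x)%:E)%E xs ->
  exists2 r, psi xs = r%:E &
    forall u s, psi u = s%:E -> a * r - dotp g (u - xs) <= a * s.
Proof.
move=> a0 hf hmin; have [hN [v hv]] := hproper.
have [r hr] : exists r, psi xs = r%:E.
  have := hmin v; have := hN xs; have := hN v; move: hv.
  case: (psi v) => [q| |]//= _ _; case: (psi xs) => [r| |]//= _; first by exists r.
  by rewrite gt0_muley ?lte_fin// addye// -EFinM -EFinD leye_eq.
(* Compare [xs] with [xs + t *: (u - xs)]: convexity makes the change of [psi] at most linear in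
   [t], and the error for [f] is of order t^2, so division by [t] leaves the vanishing term
   [t * C (u - xs)]. *)
exists r => // u s hu; apply: (@le_of_le_addM _ _ _ (C (u - xs))) => t t0 t1.
have [q hq ql] := econvex_fin hu hr (ltW t0) t1.
have := hmin (t *: u + (1 - t) *: xs); rewrite hq hr -!EFinM -!EFinD lee_fin.
have -> : t *: u + (1 - t) *: xs = xs + t *: (u - xs).
  by apply/rowP => i; rewrite !mxE; ring.
have := hf (u - xs) t t0 t1.
have : a * q <= a * (t * s + (1 - t) * r) by rewrite ler_pM2l.
move=> h1 h2 h3; rewrite -(ler_pM2l t0); lra.
Qed.

End Prox.

(** * Existence of the prox and its nonexpansiveness *)

Lemma continuous_sqnormB (R : realType) (n : nat) (y : 'rV[R]_n.+1) :
  continuous (fun u : 'rV[R]_n.+1 => sqnorm (u - y)).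
Proof.
have cB i : continuous (fun u : 'rV[R]_n.+1 => u ord0 i - y ord0 i).
  by move=> u; apply: continuousB; [exact: coord_continuous|exact: cst_continuous].
have cS (s : seq 'I_n.+1) :
    continuous (fun u : 'rV[R]_n.+1 => \sum_(i <- s) (u ord0 i - y ord0 i) ^+ 2).
  elim: s => [|i s IH].
    rewrite (_ : (fun u => _) = cst 0); first exact: cst_continuous.
    by apply/funext => u; rewrite big_nil.
  rewrite (_ : (fun u => _) = (fun u : 'rV[R]_n.+1 => u ord0 i - y ord0 i) *
      (fun u : 'rV[R]_n.+1 => u ord0 i - y ord0 i) +
      (fun u => \sum_(i <- s) (u ord0 i - y ord0 i) ^+ 2)).
    by move=> u; apply: continuousD (IH u); apply: continuousM; exact: cB.
  by apply/funext => u; rewrite big_cons expr2.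
rewrite (_ : (fun u => _) = (fun u : 'rV[R]_n.+1 =>
    \sum_(i < n.+1) (u ord0 i - y ord0 i) ^+ 2)); first exact: cS.
by apply/funext => u; rewrite sqnormE; apply: eq_bigr => i _; rewrite !mxE.
Qed.

Lemma compact_sqnormB_le (R : realType) (n : nat) (y : 'rV[R]_n.+1) (B : R) :
  compact [set u : 'rV[R]_n.+1 | sqnorm (u - y) <= B].
Proof.
apply: bounded_closed_compact; last first.
  apply: (@preimage_closed _ _ (fun u : 'rV[R]_n.+1 => sqnorm (u - y)) [set r | r <= B]).
    by move=> u _; exact: continuous_sqnormB.
  exact: closed_le.
(* A coordinate a of [u - y] satisfies 2|a| <= 1 + a^2 <= 1 + B, which bounds the sup norm without a
   square root. *)
exists (`|y| + (1 + B)); split; first exact: num_real.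
move=> M hM u /= hu; apply/ltW/(le_lt_trans _ hM).
rewrite -(subrK y u) addrC (le_trans (ler_normD _ _))// lerD2l.
rewrite [leLHS]/Num.Def.normr /= mx_normrE; apply/bigmax_leP; split=> /=.
  by have := sqnorm_ge0 (u - y); lra.
move=> [i j] _ /=; rewrite (ord1 i).
have := sqr_coord_le_sqnorm (u - y) j; have := sqr_ge0 (`|(u - y) ord0 j| - 1).
have := normr_ge0 ((u - y) ord0 j).
rewrite -(real_normK (num_real ((u - y) ord0 j))); move: `|_| => a; nra.
Qed.

Section ProxExists.
Context {R : realType} {n : nat}.
Variables (psi : 'rV[R]_n.+1 -> \bar R).
Hypotheses (hproper : proper_fun psi) (hclosed : closed_fun psi)
  (hconvex : econvex_fun psi).

(* Minimize over the epigraph, where the objective is continuous; the affine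
   minorant confines the sublevel set to a compact box. *)
Lemma prox_argmin (alpha c : R) (g xs y : 'rV[R]_n.+1) :
  0 < alpha ->
  (forall u s, psi u = s%:E -> c - dotp g (u - xs) <= s) ->
  argmin (fun u : 'rV[R]_n.+1 =>
    (alpha%:E * psi u + (2^-1 * sqnorm (u - y))%R%:E)%E) (prox alpha psi y).
Proof.
move=> a0 hminor; have [hN [v hv]] := hproper.
have psifin u r : (psi u <= r%:E)%E -> exists2 s, psi u = s%:E & s <= r.
  by move: (hN u); case: (psi u) => [s| |]//= _; rewrite ?lee_fin ?leye_eq//; exists s.
have [r0 hr0] : exists r0, psi v = r0%:E.
  by move: (hN v) hv; case: (psi v) => [s| |]//= _ _; exists s.
pose G (z : 'rV[R]_n.+1 * R) := alpha * z.2 + 2^-1 * sqnorm (z.1 - y).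
pose F0 := G (v, r0).
pose K := epigraph psi `&` [set z | G z <= F0].
have Gc : continuous G.
  have -> : G = (fun=> alpha) * (fun z => z.2) +
      (fun=> 2^-1) * (fun z => sqnorm (z.1 - y)) by [].
  move=> z; apply: continuousD; apply: continuousM; try exact: cst_continuous.
    exact: cvg_snd.
  apply: (@continuous_comp _ _ _ fst (fun u : 'rV[R]_n.+1 => sqnorm (u - y))).
    exact: cvg_fst.
  exact: continuous_sqnormB.
have Kc : closed K.
  apply: closedI => //.
  apply: (@preimage_closed _ _ G [set r | r <= F0]) => [z _|]; first exact: Gc.
  exact: closed_le.
(* Young's inequality with weight [2 * alpha] bounds [alpha * dotp g (u - y)] by
   [alpha ^+ 2 * sqnorm g] plus a quarter of [sqnorm (u - y)]. In G <= F0 another quarter survives,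
   whence [B]; putting [B] back into the minorant gives [N1]. *)
pose B := 4 * (F0 - alpha * c + alpha ^+ 2 * sqnorm g + alpha * dotp g (y - xs)).
pose N1 := c - alpha * sqnorm g - B / (4 * alpha) - dotp g (y - xs).
have Kbox (u : 'rV[R]_n.+1) (r : R) : K (u, r) ->
    sqnorm (u - y) <= B /\ N1 <= r <= F0 / alpha.
  move=> [/= hur hG].
  have [s hs sr] := psifin u r hur.
  have := hminor u s hs.
  have -> : u - xs = (u - y) + (y - xs) by rewrite addrA subrK.
  rewrite dotpDr => h1.
  have a20 : 0 < 2 * alpha by lra.
  have := young_dotp g (u - y) a20; rewrite invfM => h2.
  have h3 : alpha * (2 * dotp g (u - y)) <= 2 * alpha ^+ 2 * sqnorm g + 2^-1 * sqnorm (u - y).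
    rewrite -(ler_pM2l a0) in h2; apply: (le_trans h2).
    by rewrite le_eqVlt; apply/orP; left; apply/eqP; field; rewrite gt_eqF.
  have h4 : alpha * (c - (dotp g (u - y) + dotp g (y - xs))) <= alpha * r.
    by rewrite ler_pM2l//; lra.
  have hS := sqnorm_ge0 (u - y).
  have SB : sqnorm (u - y) <= B by rewrite /B; move: hG; rewrite /G /=; lra.
  split=> //; apply/andP; split; last first.
    by rewrite ler_pdivlMr// mulrC; move: hG; rewrite /G /=; lra.
  rewrite -(ler_pM2l a0); apply: le_trans h4.
  have -> : alpha * N1 = alpha * c - alpha ^+ 2 * sqnorm g - 4^-1 * B - alpha * dotp g (y - xs).
    by rewrite /N1; field; rewrite gt_eqF.
  lra.
have Kco : compact K.
  apply: (subclosed_compact Kc (compact_setX (@compact_sqnormB_le _ _ y B)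
    (@segment_compact _ N1 (F0 / alpha)))) => -[u r] /Kbox[] //.
have K0 : K !=set0 by exists (v, r0); split => //=; rewrite /epigraph /= hr0.
have [[u r] uK hmin] := compact_EVT_min K0 Kco (continuous_subspaceT Gc).
rewrite /prox; apply: xgetPex; exists u => w /=.
have /set_mem[/= hur hG] := uK.
have [s hs sr] := psifin u r hur; rewrite hs -EFinM -EFinD.
case hw : (psi w) => [q| |]; last by move: (hN w); rewrite hw.
  rewrite -EFinM -EFinD lee_fin.
  apply: (@le_trans _ _ (G (u, r))); first by rewrite lerD2r ler_pM2l.
  (* A finite competitor outside [K] has value above [F0], hence above the minimum over [K]. *)
  have [hq|/ltW] := leP (G (w, q)) F0; last exact: le_trans.
  by apply: (hmin (w, q)); apply/mem_set; split => //=; rewrite /epigraph /= hw.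
by rewrite gt0_muley ?lte_fin// addye// leey.
Qed.

(** The minorant says that [xs] is the prox of [xs - alpha *: s], so this is nonexpansiveness.
    Adding the variational inequality of the prox, tested at [xs], to the minorant at the prox point
    bounds the squared distance by an inner product, and Young's inequality concludes. *)
Lemma sqnorm_prox_le (alpha : R) (s xs : 'rV[R]_n.+1) (r : R) (y : 'rV[R]_n.+1) :
  0 < alpha -> psi xs = r%:E ->
  (forall u q, psi u = q%:E -> r - dotp s (u - xs) <= q) ->
  sqnorm (prox alpha psi y - xs) <= sqnorm (y + alpha *: s - xs).
Proof.
move=> a0 hr hs; set z := prox alpha psi y.
have := @argmin_subgradient R n psi hproper hconvex
  (fun u => 2^-1 * sqnorm (u - y)) alpha z (z - y) (fun v => 2^-1 * sqnorm v) a0.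
case.
- move=> v t _ _; rewrite addrAC /sqnorm !dotpE (dotpC v z) (dotpC v y); lra.
- exact: prox_argmin hs.
move=> q hq /(_ xs r hr) h1; have h2 := hs z q hq.
have h3 : alpha * (r - dotp s (z - xs)) <= alpha * q by rewrite ler_pM2l.
have h5 : dotp (z - xs) (z - xs) <= dotp (y + alpha *: s - xs) (z - xs).
  move: h1 h3; rewrite !dotpE (dotpC xs z).
  by lra.
have h6 := young_dotp (y + alpha *: s - xs) (z - xs) ltr01.
by move: h5 h6; rewrite invr1 !mul1r -!/(sqnorm _); lra.
Qed.

End ProxExists.

(* Here d = x_i - xs_i, a = grad_i f(x) - grad_i f(xs), c = h_i - grad_i f(xs):
   the two outcomes i \in S and i \notin S, weighted by p and 1 - p. *)
Lemma coord_descent (R : realFieldType) (p alpha m sigma a c d w : R) :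
  0 < p -> p <= 1 -> 0 < alpha -> 0 < m -> 0 < sigma ->
  alpha * (4 * m + sigma) <= p ->
  w = p^-1 / 2 / m ->
  p * ((d - alpha * (c + p^-1 * (a - c))) ^+ 2 + alpha * (w * a ^+ 2))
  + (1 - p) * ((d - alpha * c) ^+ 2 + alpha * (w * c ^+ 2))
  <= d ^+ 2 - 2 * alpha * (a * d) + alpha * (a ^+ 2 / m)
     + (1 - alpha * sigma) * (alpha * (w * c ^+ 2)).
Proof.
move=> p0 p1 a0 m0 s0 hp wE.
pose t := alpha / p.
have t0 : 0 < t by rewrite divr_gt0.
have alphaE : alpha = t * p by rewrite divfK// gt_eqF.
have ht : t * (4 * m + sigma) <= 1.
  by rewrite /t mulrAC ler_pdivrMr// mul1r.
(* [Q] is the second moment of the shifted estimator: c + (a - c) / p with probability p, and c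
   otherwise. *)
pose Q := p^-1 * (a - c) ^+ 2 + 2 * (a * c) - c ^+ 2.
(* The slack is exactly (1 - p)(a + c)^2 + p(a^2 + 2c^2). *)
have hQ : p * Q <= 2 * (a ^+ 2 + c ^+ 2).
  have -> : p * Q = (a - c) ^+ 2 + p * (2 * (a * c) - c ^+ 2).
    by rewrite /Q; field; rewrite gt_eqF.
  have : 0 <= (1 - p) * (a + c) ^+ 2 by rewrite mulr_ge0 ?sqr_ge0// subr_ge0.
  have : 0 <= p * (a ^+ 2 + 2 * c ^+ 2).
    by rewrite mulr_ge0 ?(ltW p0)// addr_ge0 ?sqr_ge0// mulr_ge0 ?sqr_ge0.
  lra.
(* The constant 4 of the stepsize enters here: the inequality is equivalent to [ht]. *)
have hm : 2 * t <= (1 - t * sigma) / (2 * m).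
  by rewrite ler_pdivlMr; [lra|rewrite mulr_gt0].
have hm' : (1 - t * sigma) / (2 * m) <= (2 * m)^-1.
  have m2 : 0 <= (2 * m)^-1 by rewrite invr_ge0 mulr_ge0// ltW.
  rewrite ler_piMl//.
  by have := mulr_gt0 t0 s0; lra.
have key : alpha * Q <= (2 * m)^-1 * a ^+ 2 + (1 - t * sigma) / (2 * m) * c ^+ 2.
  have h1 : alpha * Q <= 2 * t * a ^+ 2 + 2 * t * c ^+ 2.
    have : t * (p * Q) <= t * (2 * (a ^+ 2 + c ^+ 2)) by rewrite ler_pM2l.
    by rewrite alphaE; lra.
  apply: (le_trans h1); apply: lerD; apply: ler_wpM2r; rewrite ?sqr_ge0//.
  exact: le_trans hm hm'.
(* Since p w = 1 / (2m), the updated memory term costs half of [alpha * (a ^+ 2 / m)]; the other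
   half is available for the variance. The difference of the two sides is then [alpha] times the
   slack in [key]. *)
rewrite -subr_ge0 (_ : _ - _ = alpha *
  ((2 * m)^-1 * a ^+ 2 + (1 - t * sigma) / (2 * m) * c ^+ 2 - alpha * Q)).
  by rewrite mulr_ge0 ?subr_ge0// ltW.
rewrite /Q wE alphaE; move: t {ht hm hm' key t0 alphaE} => t.
by field; rewrite !gt_eqF.
Qed.

(** * One-step contraction of the Lyapunov function *)

Section Descent.
Context {R : realType} {n : nat}.
Variables (f : 'rV[R]_n.+1 -> R) (psi : 'rV[R]_n.+1 -> \bar R)
  (xs : 'rV[R]_n.+1) (sigma alpha : R) (m p : 'I_n.+1 -> R).
Hypotheses (hf_convex : convex_function setT f)
  (hproper : proper_fun psi) (hclosed : closed_fun psi)
  (hconvex : econvex_fun psi)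
  (hxs : argmin (fun x => ((f x)%:E + psi x)%E) xs)
  (hsigma : 0 < sigma) (hqsc : quasi_strongly_convex sigma f xs)
  (hm : forall i, 0 < m i) (hsmooth : diag_smooth m f)
  (hp : forall i, 0 < p i) (a0 : 0 < alpha)
  (halpha : forall i, alpha * (4 * m i + sigma) <= p i).

Local Notation b := (fun i => Num.sqrt ((p i)^-1 / 2)).
Local Notation s := (grad f xs).

Lemma lyapunov_ge0 (c : 'I_n.+1 -> R) xh :
  0 <= lyapunov alpha m c (grad f) xs xh.
Proof.
rewrite addr_ge0 ?sqnorm_ge0// mulr_ge0 ?(ltW a0)// sumr_ge0// => i _.
by rewrite mulr_ge0 ?sqr_ge0// divr_ge0 ?sqr_ge0// ltW.
Qed.

(** Smoothness supplies the quadratic upper bound that [argmin_subgradient] asks of [f]. *)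
Lemma composite_subgradient : exists2 r, psi xs = r%:E &
  forall u q, psi u = q%:E -> r - dotp s (u - xs) <= q.
Proof.
have [||r hr hs] := argmin_subgradient hproper hconvex (f := f) (xs := xs)
  (g := s) (C := fun v => 2^-1 * \sum_(i < n.+1) m i * v ord0 i ^+ 2) ltr01.
- move=> v t t0 t1; have := hsmooth (xs + t *: v) xs.
  have -> : xs + t *: v - xs = t *: v by rewrite addrAC subrr add0r.
  rewrite dotpZr => /le_trans; apply; rewrite lerD2l [leRHS]mulrCA.
  rewrite ler_pM2l ?invr_gt0// mulr_sumr le_eqVlt; apply/orP; left; apply/eqP.
  by apply: eq_bigr => i _; rewrite !mxE; ring.
- by move=> u; rewrite !mul1e !(addeC _ (f _)%:E); exact: hxs.
by exists r => // u q hu; have := hs u q hu; rewrite !mul1r.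
Qed.

(** Coordinate i's share of the Lyapunov function after a step, with the prox distance replaced by
    its nonexpansive bound. It sees the drawn set only through membership of i, so only the
    marginals [p i] matter in expectation. *)
Definition coord_step (x h : 'rV[R]_n.+1) (i : 'I_n.+1) (drawn : bool) : R :=
  let a := grad f x ord0 i - s ord0 i in
  let c := h ord0 i - s ord0 i in
  let d := x ord0 i - xs ord0 i in
  let w := (p i)^-1 / 2 / m i in
  if drawn then (d - alpha * (c + (p i)^-1 * (a - c))) ^+ 2 + alpha * (w * a ^+ 2)
  else (d - alpha * c) ^+ 2 + alpha * (w * c ^+ 2).

Lemma sum_basis_vecE (S : {set 'I_n.+1}) (F : 'I_n.+1 -> R) i :
  (\sum_(j in S) F j *: basis_vec R j) ord0 i = if i \in S then F i else 0.
Proof.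
rewrite summxE; case: ifPn => iS.
  rewrite (bigD1 i)//= big1 ?addr0 => [|j /andP[_ ji]]; rewrite !mxE /=.
    by rewrite !eqxx mulr1.
  by rewrite eq_sym (negbTE ji) mulr0.
rewrite big1// => j jS; rewrite !mxE /=; case: eqP => [ij|]; last by rewrite mulr0.
by rewrite ij jS in iS.
Qed.

Lemma lyapunov_step_le S x h :
  lyapunov alpha m b (grad f) xs (sega_step alpha psi (grad f) p S (x, h))
  <= \sum_(i < n.+1) coord_step x h i (i \in S).
Proof.
have [r hr hs] := composite_subgradient.
rewrite /lyapunov /sega_step /=.
set g := h + _; set h' := h + _.
have -> : \sum_(i < n.+1) coord_step x h i (i \in S) =
    sqnorm (x - alpha *: g + alpha *: s - xs) + alpha * \sum_(i < n.+1)
      b i ^+ 2 / m i * (h' ord0 i - s ord0 i) ^+ 2.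
  rewrite sqnormE mulr_sumr -big_split; apply: eq_bigr => i _ /=.
  rewrite sqr_sqrtr ?divr_ge0 ?invr_ge0 ?ltW//.
  have -> : (x - alpha *: g + alpha *: s - xs) ord0 i =
      x ord0 i - alpha * g ord0 i + alpha * s ord0 i - xs ord0 i.
    by rewrite !mxE.
  have -> : g ord0 i = h ord0 i + (if i \in S then (p i)^-1 * (grad f x ord0 i - h ord0 i) else 0).
    by rewrite [LHS]mxE sum_basis_vecE.
  have -> : h' ord0 i = h ord0 i + (if i \in S then grad f x ord0 i - h ord0 i else 0).
    by rewrite [LHS]mxE sum_basis_vecE.
  rewrite /coord_step; case: ifP => _; ring.
by rewrite lerD2r; exact: sqnorm_prox_le hs.
Qed.

Section Law.
Variable q : {set 'I_n.+1} -> R.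
Hypotheses (q0 : forall S, 0 <= q S) (q1 : \sum_S q S = 1)
  (hpq : forall i, \sum_S q S * (i \in S)%:R = p i).

Lemma marginal_le1 i : p i <= 1.
Proof.
rewrite -hpq -[leRHS]q1 ler_sum// => S _; rewrite -[leRHS]mulr1 ler_wpM2l//.
by case: (i \in S).
Qed.

Lemma lyapunov_descent xh :
  \sum_S q S * lyapunov alpha m b (grad f) xs
      (sega_step alpha psi (grad f) p S xh)
  <= (1 - alpha * sigma) * lyapunov alpha m b (grad f) xs xh.
Proof.
case: xh => x h.
apply: (@le_trans _ _ (\sum_S q S * \sum_(i < n.+1) coord_step x h i (i \in S))).
  by apply: ler_sum => S _; rewrite ler_wpM2l// lyapunov_step_le.
under eq_bigr do rewrite mulr_sumr.
rewrite exchange_big /=.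
have law i : \sum_S q S * coord_step x h i (i \in S) =
    p i * coord_step x h i true + (1 - p i) * coord_step x h i false.
  rewrite -q1 -hpq -sumrB !mulr_suml -big_split; apply: eq_bigr => S _ /=.
  by case: (i \in S) => /=; ring.
under eq_bigr do rewrite law.
apply: le_trans (ler_sum _ (fun i _ => coord_descent _ _ _ (hp i) (marginal_le1 i) a0 (hm i)
  hsigma (halpha i) erefl)) _.
rewrite 3!big_split /= -!mulr_sumr.
have h1 := bregman_ge hf_convex hsmooth hm x xs.
have h2 := hqsc x.
have h3 : \sum_(i < n.+1) (x ord0 i - xs ord0 i) ^+ 2 = sqnorm (x - xs).
  by rewrite sqnormE; apply: eq_bigr => i _; rewrite !mxE.
have h4 : \sum_(i < n.+1) - (2 * alpha *
    ((grad f x ord0 i - s ord0 i) * (x ord0 i - xs ord0 i))) =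
    - (2 * alpha * dotp (grad f x - s) (x - xs)).
  rewrite sumrN -mulr_sumr; congr (- (_ * _)); apply: eq_bigr => i _.
  have sub_coord (u v : 'rV[R]_n.+1) : (u - v) ord0 i = u ord0 i - v ord0 i.
    by rewrite !mxE.
  by rewrite !sub_coord.
have h5 : lyapunov alpha m b (grad f) xs (x, h) = sqnorm (x - xs) + alpha *
    \sum_(i < n.+1) (p i)^-1 / 2 / m i * (h ord0 i - s ord0 i) ^+ 2.
  congr (_ + _ * _); apply: eq_bigr => i _.
  by rewrite sqr_sqrtr// divr_ge0// invr_ge0 ltW.
rewrite h3 h4 h5 mulrDr lerD2r dotpDl dotpNl.
have h6 : dotp (grad f x) (xs - x) = - dotp (grad f x) (x - xs).
  by rewrite -dotpNr opprB.
rewrite h6 in h2.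
set A := \sum_(i < n.+1) _ in h1 *.
(* The sum of [h1] and [h2], in which the values of [f] cancel. Doubled, it absorbs [alpha * A] and
   leaves the contraction term [- alpha * sigma * sqnorm (x - xs)]. *)
have : alpha * (2^-1 * A + sigma / 2 * sqnorm (x - xs)) <=
    alpha * (dotp (grad f x) (x - xs) - dotp s (x - xs)).
  by rewrite ler_pM2l//; lra.
lra.
Qed.

End Law.
End Descent.

(** * Expectations of finitely valued variables and independence *)

Section FiniteExpectation.
Context {d : measure_display} {T : measurableType d} {R : realType}
  (P : probability T R).

(** Decompose [g \o X] into indicators of the fibres of [X]. *)
Lemma expectation_finite (F : finType) (X : T -> F) (g : F -> R) :
  (forall x, measurable (X @^-1` [set x])) -> (forall x, 0 <= g x) ->
  ('E_P[g \o X] = (\sum_x g x * fine (P (X @^-1` [set x])))%R%:E)%E.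
Proof.
move=> mX g0; rewrite unlock.
under eq_integral => w _.
  rewrite (_ : (_ \o X) w = \sum_x g x * \1_(X @^-1` [set x]) w); last first.
    rewrite (bigD1 (X w))//= big1 ?addr0 => [|x xX].
      by rewrite indicE mem_set// mulr1.
    by rewrite indicE memNset ?mulr0//= => Xx; rewrite Xx eqxx in xX.
  rewrite -sumEFin. over.
rewrite ge0_integral_sum//=; first last.
- by move=> x w _; rewrite lee_fin mulr_ge0.
- move=> x; apply/measurable_EFinP; apply: measurable_funM => //.
rewrite -sumEFin; apply: eq_bigr => x _.
under eq_integral do rewrite EFinM.
rewrite ge0_integralZl//=; last by rewrite lee_fin.
- by rewrite integral_indic// setIT EFinM fineK// fin_num_measure.
- by apply/measurable_EFinP.
Qed.

End FiniteExpectation.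

Section Independence.
Context {d : measure_display} {T : measurableType d} {R : realType}
  (P : probability T R) (n : nat) (L : T -> {set 'I_n.+1})
  (Ls : nat -> T -> {set 'I_n.+1}).
Hypothesis (hLs : independent_copies P L Ls).

(** A tuple rather than a sequence, so that the history takes values in a finite type. *)
Definition past k w : k.-tuple {set 'I_n.+1} := [tuple of mkseq (fun j => Ls j w) k].

Lemma tnth_past k w j : tnth (past k w) j = Ls j w.
Proof. by rewrite (tnth_nth finset.set0) nth_mkseq. Qed.

Lemma measurable_past k t : measurable (past k @^-1` [set t]).
Proof.
have [mLs _ _] := hLs.
rewrite (_ : _ @^-1` _ = \bigcap_(j in [set: 'I_k]) Ls j @^-1` [set tnth t j]).
  by apply: fin_bigcap_measurable => //= j _; exact: mLs.
apply/seteqP; split=> w /=.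
  by move=> <- j _; exact/esym/tnth_past.
by move=> h; apply: eq_from_tnth => j; rewrite tnth_past; exact: h.
Qed.

(** The tower property: the pair of history and new draw has finitely many values, and independence
    factors the probability of each. *)
Lemma expectation_step k (phi : k.-tuple {set 'I_n.+1} -> {set 'I_n.+1} -> R) :
  (forall t S, 0 <= phi t S) ->
  ('E_P[fun w => phi (past k w) (Ls k w)] =
   'E_P[fun w => (\sum_S fine (P (L @^-1` [set S])) * phi (past k w) S)%R])%E.
Proof.
move=> phi0; have [mLs idLs indLs] := hLs.
pose X w := (past k w, Ls k w).
have XE t S : X @^-1` [set (t, S)] =
    Ls k @^-1` [set S] `&` (fun w => mkseq (fun j => Ls j w) k) @^-1` [set tval t].
  apply/seteqP; split => w; rewrite /X /=; first by case=> <- <-.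
  by move=> [-> tE]; congr (_, _); exact: val_inj.
have pE t : (fun w => mkseq (fun j => Ls j w) k) @^-1` [set tval t] = past k @^-1` [set t].
  apply/seteqP; split => w /=; last by move=> <-.
  by move=> tE; exact: val_inj.
rewrite (_ : (fun w => _) = (fun z => phi z.1 z.2) \o X)//.
rewrite expectation_finite; last by move=> [t S].
  2: by move=> [t S]; rewrite XE pE; apply: measurableI; [exact: mLs|exact: measurable_past].
rewrite (_ : (fun w => \sum_S _) =
  (fun t => \sum_S fine (P (L @^-1` [set S])) * phi t S) \o past k)//.
rewrite expectation_finite; first last.
- by move=> t; apply: sumr_ge0 => S _; rewrite mulr_ge0// fine_ge0.
- exact: measurable_past.
congr EFin.
rewrite (eq_bigr (fun z => phi z.1 z.2 * fine (P (X @^-1` [set (z.1, z.2)])))); last by case.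
rewrite -(pair_bigA _ (fun t S => phi t S * fine (P (X @^-1` [set (t, S)]))))/=.
apply: eq_bigr => t _; rewrite mulr_suml; apply: eq_bigr => S _.
rewrite XE indLs pE fineM ?fin_num_measure//; last 2 first.
- exact: mLs.
- exact: measurable_past.
by rewrite idLs; ring.
Qed.

End Independence.

(** * Total mass and marginals of the sampling law *)

Section LawOfL.
Context {d : measure_display} {T : measurableType d} {R : realType}
  (P : probability T R) (n : nat) (L : T -> {set 'I_n.+1}).
Hypothesis hL : random_set L.

Lemma law_sum1 : \sum_S fine (P (L @^-1` [set S])) = 1.
Proof.
have := expectation_finite P (g := fun=> 1) hL (fun=> ler01).
rewrite (_ : _ \o L = cst 1)// expectation_cst => -[->].
by apply: eq_bigr => S _; rewrite mul1r.
Qed.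

Lemma law_marginal i :
  \sum_S fine (P (L @^-1` [set S])) * (i \in S)%:R = inclusion_prob P L i.
Proof.
have mi : measurable [set w | i \in L w].
  rewrite (_ : mkset _ = \bigcup_(S in [set S : {set 'I_n.+1} | i \in S]) L @^-1` [set S]).
    by apply: fin_bigcup_measurable => // S _; exact: hL.
  by apply/seteqP; split => w /= => [iL|[S /= iS ->//]]; exists (L w).
have := expectation_finite P (g := fun S : {set 'I_n.+1} => (i \in S)%:R) hL (fun S => ler0n _ _).
rewrite (_ : _ \o L = \1_[set w | i \in L w]); last first.
  by apply/funext => w; rewrite indicE /=; congr (_%:R); rewrite mem_setE.
rewrite expectation_indic// /inclusion_prob => ->/=.
by apply: eq_bigr => S _; rewrite mulrC.
Qed.

End LawOfL.

(** Makes the k-th iterate a function of the first k draws, hence of [past]. *)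
Lemma eq_sega (R : realType) (n : nat) (alpha : R)
    (psi : 'rV[R]_n.+1 -> \bar R) (gf : 'rV[R]_n.+1 -> 'rV[R]_n.+1)
    (p : 'I_n.+1 -> R) (x0 : 'rV[R]_n.+1) (Ss Ss' : nat -> {set 'I_n.+1}) k :
  (forall j, (j < k)%N -> Ss j = Ss' j) ->
  sega alpha psi gf p x0 Ss k = sega alpha psi gf p x0 Ss' k.
Proof.
elim: k => //= k IH eqS; rewrite eqS// IH// => j jk.
by apply: eqS; exact: ltnW.
Qed.

Lemma min_ord_le (R : realType) (n : nat) (F : 'I_n.+1 -> R) i :
  min_ord F <= F i.
Proof. exact: bigmin_le. Qed.

(** The fold starts at [F ord0], so each intermediate value is some [F j]. *)
Lemma min_ord_eq (R : realType) (n : nat) (F : 'I_n.+1 -> R) :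
  exists i, min_ord F = F i.
Proof.
rewrite /min_ord; elim/big_rec: _ => [|i r _ [j ->]]; first by exists ord0.
by rewrite /Num.min; case: ifP => _; [exists i|exists j].
Qed.

Lemma max_ord_ge (R : realType) (n : nat) (F : 'I_n.+1 -> R) i :
  F i <= max_ord F.
Proof. exact: le_bigmax. Qed.

(** * Geometric decay in expectation and iteration complexity *)

Theorem corollaryH2 (R : realType) (n : nat)
    (f : 'rV[R]_n.+1 -> R) (psi : 'rV[R]_n.+1 -> \bar R)
    (xs : 'rV[R]_n.+1) (sigma : R) (m : 'I_n.+1 -> R)
    (hf_diff : forall x, differentiable f x)
    (hf_convex : convex_function setT f)
    (hpsi_proper : proper_fun psi)
    (hpsi_closed : closed_fun psi)
    (hpsi_convex : econvex_fun psi)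
    (hxs : argmin (fun x => ((f x)%:E + psi x)%E) = [set xs])
    (hsigma : 0 < sigma)
    (hqsc : quasi_strongly_convex sigma f xs)
    (hm : forall i, 0 < m i)
    (hsmooth : diag_smooth m f)
    (disp : measure_display) (T : measurableType disp) (P : probability T R)
    (L : T -> {set 'I_n.+1}) (hL : random_set L)
    (p : 'I_n.+1 -> R) (hp_def : forall i, p i = inclusion_prob P L i)
    (hp : forall i, 0 < p i)
    (Ls : nat -> T -> {set 'I_n.+1}) (hLs : independent_copies P L Ls)
    (alpha : R) (halpha : alpha = min_ord (fun i => p i / (4 * m i + sigma)))
    (x0 : 'rV[R]_n.+1) :
  exists b : 'I_n.+1 -> R, (forall i, 0 < b i) /\
    let Psi (k : nat) (w : T) : R :=
      lyapunov alpha m b (grad f) xs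
        (sega alpha psi (grad f) p x0 (fun j => Ls j w) k) in
    let Psi0 : R := lyapunov alpha m b (grad f) xs (x0, 0) in
    forall eps : R, 0 < eps -> eps < 1 ->
    forall k : nat,
      max_ord (fun i => (4 * m i + sigma) / (p i * sigma)) * ln eps^-1
        <= k%:R ->
      ('E_P[Psi k] <= (eps * Psi0)%R%:E)%E.
Proof.
have den i : 0 < 4 * m i + sigma by rewrite addr_gt0// mulr_gt0.
have [i0 alphaE] := min_ord_eq (fun i => p i / (4 * m i + sigma)).
have a0 : 0 < alpha by rewrite halpha alphaE divr_gt0.
have ha i : alpha * (4 * m i + sigma) <= p i.
  by rewrite -ler_pdivlMr// halpha; exact: (min_ord_le (fun i => _)).
exists (fun i => Num.sqrt ((p i)^-1 / 2)); split.
  by move=> i; rewrite sqrtr_gt0 divr_gt0// invr_gt0.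
move=> Psi Psi0 eps eps0 eps1 k hk.
have hmin : argmin (fun x => ((f x)%:E + psi x)%E) xs by rewrite hxs.
pose q S := fine (P (L @^-1` [set S])).
have q0 S : 0 <= q S by exact: fine_ge0.
have q1 : \sum_S q S = 1 := law_sum1 P hL.
have hpq i : \sum_S q S * (i \in S)%:R = p i by rewrite hp_def law_marginal.
pose V := lyapunov alpha m (fun i => Num.sqrt ((p i)^-1 / 2))
    (grad f) xs.
have descent := lyapunov_descent hf_convex hpsi_proper hpsi_closed hpsi_convex
  hmin hsigma hqsc hm hsmooth hp a0 ha q0 q1 hpq.
have V_ge0 xh : 0 <= V xh by exact: lyapunov_ge0.
(* From [alpha * (4 * m i0 + sigma) <= p i0 <= 1]; this allows multiplying the induction hypothesis
   by the contraction factor. *)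
have rho0 : 0 <= 1 - alpha * sigma.
  have := marginal_le1 q0 q1 hpq i0; have := ha i0.
  by have := mulr_gt0 a0 (hm i0); lra.
(* The default [finset.set0] is never read: iterate [j] uses only the draws before [j]. *)
pose st j (t : j.-tuple {set 'I_n.+1}) :=
  sega alpha psi (grad f) p x0 (nth finset.set0 t) j.
have PsiE j w : Psi j w = V (st j (past Ls j w)).
  by congr V; apply: eq_sega => l lj; rewrite nth_mkseq.
have decay j : ('E_P[Psi j] <= ((1 - alpha * sigma) ^+ j * Psi0)%:E)%E.
  elim: j => [|j]; first by rewrite expr0 mul1r (_ : Psi 0 = cst Psi0)// expectation_cst.
  rewrite (_ : Psi j = (fun t => V (st j t)) \o past Ls j); last first.
    by apply/funext => w; exact: PsiE.
  rewrite (expectation_finite P (measurable_past hLs (k := j)))// lee_fin => IH.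
  rewrite (_ : Psi j.+1 = fun w => V (sega_step alpha psi (grad f) p (Ls j w) (st j (past Ls j w)))); last first.
    apply/funext => w; congr V => /=; congr sega_step.
    by apply: eq_sega => l lj; rewrite nth_mkseq.
  rewrite (expectation_step hLs (phi := fun t S => V
    (sega_step alpha psi (grad f) p S (st j t))))//.
  rewrite (_ : (fun w => _) = (fun t => \sum_S q S * V
    (sega_step alpha psi (grad f) p S (st j t))) \o past Ls j)//.
  rewrite (expectation_finite P (measurable_past hLs (k := j))); last first.
    by move=> t; apply: sumr_ge0 => S _; rewrite mulr_ge0.
  rewrite lee_fin exprS -mulrA; apply: le_trans (ler_wpM2l rho0 IH).
  rewrite mulr_sumr; apply: ler_sum => t _; rewrite mulrA ler_wpM2r ?fine_ge0//.
apply: (le_trans (decay k)); rewrite lee_fin; apply: ler_wpM2r; first exact: V_ge0.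
(* Bounding the geometric rate by an exponential reduces the claim to [h2]. *)
have h1 : 1 - alpha * sigma <= expR (- (alpha * sigma)) by exact: expR_ge1Dx.
have ln0 : 0 <= ln eps^-1 by rewrite ln_ge0// invf_ge1// ltW.
have h2 : ln eps^-1 <= alpha * sigma * k%:R.
  have as0 : 0 < alpha * sigma by rewrite mulr_gt0.
  rewrite -ler_pdivrMl//; apply: le_trans hk.
  rewrite ler_wpM2r//.
  (* The minimum defining [alpha] is attained at [i0], so this inverse is one of the terms under the
     maximum. *)
  have -> : (alpha * sigma)^-1 = (4 * m i0 + sigma) / (p i0 * sigma).
    by rewrite halpha alphaE; field; rewrite !gt_eqF.
  exact: (max_ord_ge (fun i => _)).
apply: (@le_trans _ _ (expR (- (alpha * sigma)) ^+ k)).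
  by apply: lerXn2r; rewrite ?nnegrE ?expR_ge0.
rewrite -expRM_natr mulNr -[leRHS](lnK eps0) ler_expR.
by rewrite -[leRHS]opprK -lnV// lerN2.
Qed.
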